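(* Let $\big(S,\mathcal{F},F^*,\{c^j\}_{j\in[k]},-\infty,+\infty,\operatorname{span}_w(\cdot)\big)$ be a feasible unconstrained minimum-cost inverse optimization problem with $k$ cost functions under the weighted span objective. Then $$\min\{\operatorname{span}_w(p)\mid p\in\mathbb{R}^S \text{ is a feasible deviation vector}\}=\max\{0,\omega_1,\omega_2\},$$ where $$\omega_1:=\max\left\{\frac{c^j(F^* )-c^j(F'')}{\frac1w(F^*\setminus F'')}\ \middle|\ j\in[k],\ F''\in\mathcal{F}\setminus\{F^*\},\ \tfrac1w(F'')=\tfrac1w(F^* )\right\}$$ and $$\omega_2:=\max\left\{\frac{\dfrac{c^{j_1}(F^* )-c^{j_1}(F')}{\frac1w(F^* )-\frac1w(F')}-\dfrac{c^{j_2}(F^* )-c^{j_2}(F''')}{\frac1w(F^* )-\frac1w(F''')}}{\dfrac{\frac1w(F^*\setminus F')}{\frac1w(F^* )-\frac1w(F')}-\dfrac{\frac1w(F^*\setminus F''')}{\frac1w(F^* )-\frac1w(F''')}}\ \middle|\ j_1,j_2\in[k],\ F',F'''\in\mathcal{F},\ \tfrac1w(F')<\tfrac1w(F^* )<\tfrac1w(F''')\right\}.$$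
   Context: $S$ is a finite nonempty ground set, $\mathcal{F}\subseteq 2^S$ is a collection of feasible solutions, $F^*\in\mathcal{F}$ is an input solution, $k$ is a positive integer, $[k]=\{1,\dots,k\}$, $c^1,\dots,c^k\in\mathbb{R}^S$ are cost functions, and $w\in\mathbb{R}_+^S$ is a positive weight function. Standing assumption: $w$ is scaled so that $1/w(s)$ is an integer for each $s\in S$. For a function $f\in\mathbb{R}^S$ and $X\subseteq S$, $f(X):=\sum_{s\in X}f(s)$ (empty sums are $0$), and $\frac1w(X):=\sum_{s\in X}\frac{1}{w(s)}$. For $p\in\mathbb{R}^S$, $\operatorname{span}_w(p):=\max\{w(s)p(s)\mid s\in S\}-\min\{w(s)p(s)\mid s\in S\}$. In the unconstrained problem (no lower or upper bounds on $p$), a deviation vector $p\in\mathbb{R}^S$ is feasible if for every $j\in[k]$, $F^*$ is a minimum-cost member of $\mathcal{F}$ with respect to $c^j-p$, i.e. $(c^j-p)(F^* )\le(c^j-p)(F)$ for all $F\in\mathcal{F}$. The problem is feasible if a feasible deviation vector exists. A maximum over an empty set is regarded as $-\infty$ (so $\omega_1$ or $\omega_2$ is ignored in $\max\{0,\omega_1,\omega_2\}$ when the corresponding index set is empty). *)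

(* Defs.v *)
From mathcomp Require Import all_boot all_order all_algebra archimedean.
From mathcomp Require Import classical_sets constructive_ereal reals.

Set Implicit Arguments.
Unset Strict Implicit.
Unset Printing Implicit Defensive.

Import Order.TTheory GRing.Theory Num.Theory.
Local Open Scope ring_scope.

Section InverseOptimization.
Context {R : realType} {S : finType}.

Definition setsum (f : S -> R) (X : {set S}) : R := \sum_(s in X) f s.

Definition invw (w : S -> R) (X : {set S}) : R := setsum (fun s => 1 / w s) X.

(* Extrema of finite families are taken in the extended reals, with the
   convention max(empty) = -oo and min(empty) = +oo; the value below is thus a
   real number as soon as S is nonempty. *)
Definition span_w (w p : S -> R) : \bar R :=
  (\big[maxe/-oo]_(s : S) (w s * p s)%:E
   - \big[mine/+oo]_(s : S) (w s * p s)%:E)%E.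

Definition min_cost (FF : {set {set S}}) (c : S -> R) (Fs : {set S}) : Prop :=
  Fs \in FF /\ forall F, F \in FF -> setsum c Fs <= setsum c F.

Definition feasible_deviation (FF : {set {set S}}) (Fs : {set S}) (k : nat)
    (c : 'I_k -> S -> R) (p : S -> R) : Prop :=
  forall j : 'I_k, min_cost FF (fun s => c j s - p s) Fs.

(* For w > 0 all denominators below are nonzero: F2 != Fs of equal total 1/w
   misses an element of Fs, and in omega2 the outer denominator is a positive
   number minus a nonpositive one. *)
Definition omega1 (FF : {set {set S}}) (Fs : {set S}) (k : nat)
    (c : 'I_k -> S -> R) (w : S -> R) : \bar R :=
  \big[maxe/-oo%E]_(j < k)
   \big[maxe/-oo%E]_(F2 in FF :\ Fs | invw w F2 == invw w Fs)
    ((setsum (c j) Fs - setsum (c j) F2) / invw w (Fs :\: F2))%:E.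

Definition omega2 (FF : {set {set S}}) (Fs : {set S}) (k : nat)
    (c : 'I_k -> S -> R) (w : S -> R) : \bar R :=
  \big[maxe/-oo%E]_(j1 < k) \big[maxe/-oo%E]_(j2 < k)
   \big[maxe/-oo%E]_(F1 in FF | invw w F1 < invw w Fs)
    \big[maxe/-oo%E]_(F3 in FF | invw w Fs < invw w F3)
     (((setsum (c j1) Fs - setsum (c j1) F1) / (invw w Fs - invw w F1)
       - (setsum (c j2) Fs - setsum (c j2) F3) / (invw w Fs - invw w F3))
      / (invw w (Fs :\: F1) / (invw w Fs - invw w F1)
         - invw w (Fs :\: F3) / (invw w Fs - invw w F3)))%:E.

End InverseOptimization.

Definition is_min {R : realType} (A : set (\bar R)) (m : \bar R) : Prop :=
  A m /\ lbound A m.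

(* Main.v *)
Require Import Defs.
From mathcomp Require Import all_boot all_order all_algebra archimedean.
From mathcomp Require Import classical_sets constructive_ereal reals.
From mathcomp Require Import ring lra.
Import Order.TTheory GRing.Theory Num.Theory.
Local Open Scope classical_set_scope.
Local Open Scope ring_scope.

(** Write [d] for [c j Fs - c j F], [a] for the total 1/w of [Fs :\: F], and
    [b] for the difference of the totals 1/w of [Fs] and [F].  A deviation
    vector [p] is feasible iff [d <= p(Fs) - p(F)] for all [j] and [F].

    If the weighted values [w s * p s] lie in an interval [[m, m + delta]], then
    [p(Fs) - p(F) <= delta * a + m * b] ([setsum_diff_le]), because the
    difference is largest when the weighted value is [m + delta] on
    [Fs :\: F] and [m] on [F :\: Fs].  The vector [two_level Fs w delta m],
    with weighted value [m + delta] on [Fs] and [m] off [Fs], attains this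
    bound for every [F] at the same time ([two_level_diff]).  So some feasible
    vector has span at most [delta >= 0] iff some real [m] satisfies
    [d <= delta * a + m * b] for all [j] and [F].

    It remains to eliminate [m] from this system of linear inequalities
    ([omega_leP]).  The rows with [b = 0] do not contain [m] and give [omega1];
    among them only [F = Fs], whose row reads [0 <= 0], has [a = 0].  The rows with [b > 0] bound [m] from below and those with [b < 0] from
    above; an [m] exists iff each lower bound is at most each upper bound
    (one Fourier-Motzkin step, [exists_between]), and solving these pairwise
    comparisons for [delta] gives [omega2].  The minimum span is therefore the
    least [delta >= 0] with [omega1 <= delta] and [omega2 <= delta]. *)

(** * Sums over set differences and the span *)

Section Sums.
Context {R : realType} {S : finType}.
Implicit Types (f p w : S -> R) (A B F Fs : {set S}).

Lemma setsum_diff f A B :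
  setsum f A - setsum f B = setsum f (A :\: B) - setsum f (B :\: A).
Proof.
rewrite /setsum (big_setID B) /= [X in _ - X](big_setID A) /= [B :&: A]finset.setIC.
by rewrite opprD addrACA subrr add0r.
Qed.

Lemma setsum_scale f w A (x : R) :
  (forall s, s \in A -> f s = x * (1 / w s)) -> setsum f A = x * invw w A.
Proof. by move=> fE; rewrite /invw /setsum mulr_sumr; apply: eq_bigr. Qed.

Definition two_level Fs w (delta m : R) (s : S) : R :=
  (if s \in Fs then m + delta else m) * (1 / w s).

Section Weight.
Variable w : S -> R.
Hypothesis hw : forall s, 0 < w s.

Lemma invw_ge0 A : 0 <= invw w A.
Proof. by apply: sumr_ge0 => s _; rewrite divr_ge0 // ltW. Qed.

Lemma invw_gt0 A : A != finset.set0 -> 0 < invw w A.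
Proof.
move=> /set0Pn[s sA]; rewrite /invw /setsum (big_setD1 s) //=.
by rewrite ltr_wpDr ?divr_gt0 // invw_ge0.
Qed.

Lemma invw_diff_le A B : invw w A - invw w B <= invw w (A :\: B).
Proof. by rewrite /invw setsum_diff gerBl invw_ge0. Qed.

Lemma invw_setD_gt0 A B : B != A -> invw w B = invw w A -> 0 < invw w (A :\: B).
Proof.
(* If A is inside B, then B minus A is a nonempty set of total 1/w zero. *)
move=> BA eqw; apply: invw_gt0; apply: contraNneq BA => AB0.
have := setsum_diff (fun s => 1 / w s) A B.
rewrite -/(invw w _) -/(invw w _) AB0 eqw subrr /setsum big_set0 add0r.
move/esym/eqP; rewrite oppr_eq0 => BA0; rewrite finset.eqEsubset.
rewrite -!finset.setD_eq0 AB0 eqxx andbT.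
by apply: contraTT BA0 => /invw_gt0 /lt0r_neq0.
Qed.

Lemma setsum_le_invw p A {x : R} :
  (forall s, w s * p s <= x) -> setsum p A <= x * invw w A.
Proof.
move=> px; rewrite /invw /setsum mulr_sumr; apply: ler_sum => s _.
by rewrite mul1r ler_pdivlMr // mulrC.
Qed.

Lemma setsum_ge_invw p A {x : R} :
  (forall s, x <= w s * p s) -> x * invw w A <= setsum p A.
Proof.
move=> px; rewrite /invw /setsum mulr_sumr; apply: ler_sum => s _.
by rewrite mul1r ler_pdivrMr // mulrC.
Qed.

(** The part of [p] on the intersection of [Fs] and [F] cancels, so only the
    upper bound on [Fs :\: F] and the lower bound on [F :\: Fs] are used. *)
Lemma setsum_diff_le {p} {delta m : R} Fs F :
  (forall s, m <= w s * p s) -> (forall s, w s * p s <= m + delta) ->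
  setsum p Fs - setsum p F
    <= delta * invw w (Fs :\: F) + m * (invw w Fs - invw w F).
Proof.
move=> pm pM; rewrite setsum_diff /invw [X in m * X]setsum_diff.
have := setsum_le_invw _ (Fs :\: F) pM.
have := setsum_ge_invw _ (F :\: Fs) pm.
rewrite /invw; lra.
Qed.

Lemma two_level_diff (delta m : R) Fs F :
  setsum (two_level Fs w delta m) Fs - setsum (two_level Fs w delta m) F
    = delta * invw w (Fs :\: F) + m * (invw w Fs - invw w F).
Proof.
rewrite setsum_diff /invw [X in m * X]setsum_diff.
rewrite (@setsum_scale _ w (Fs :\: F) (m + delta)); last first.
  by move=> s; rewrite inE /two_level => /andP[_ ->].
rewrite (@setsum_scale _ w (F :\: Fs) m); last first.
  by move=> s; rewrite inE /two_level => /andP[/negbTE-> _].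
rewrite /invw; ring.
Qed.

Lemma two_level_weighted (delta m : R) Fs s :
  w s * two_level Fs w delta m s = if s \in Fs then m + delta else m.
Proof. by rewrite /two_level mulrCA mul1r divff ?mulr1 // lt0r_neq0. Qed.

End Weight.

Lemma span_wP w p : (0 < #|S|)%N ->
  exists M m : R, [/\ span_w w p = (M - m)%:E,
    forall s, m <= w s * p s <= M &
    exists s t, m = w s * p s /\ M = w t * p t].
Proof.
case/card_gt0P=> s0 _; pose v s := w s * p s.
exists (v [arg max_(s > s0) v s]%O), (v [arg min_(s < s0) v s]%O).
case: Order.TotalTheory.arg_maxP => // t _ vt.
case: Order.TotalTheory.arg_minP => // r _ vr.
split; last by exists r, t.
  rewrite /span_w EFinB; congr (_ - _)%E; apply/eqP; rewrite eq_le.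
    apply/andP; split; last exact: (le_bigmax (-oo)%E (fun s => (v s)%:E)).
    by apply/bigmax_leP; split=> [|s _]; rewrite ?leNye // lee_fin; exact: vt.
  apply/andP; split; first exact: (bigmin_le _ _ (fun s => (v s)%:E)).
  by apply/bigmin_geP; split=> [|s _]; rewrite ?leey // lee_fin; exact: vr.
by move=> s; apply/andP; split; [exact: vr | exact: vt].
Qed.

Lemma feasible_deviationE {FF : {set {set S}}} {Fs k}
    {c : 'I_k -> S -> R} {p} :
  Fs \in FF ->
  feasible_deviation FF Fs c p <->
  forall j F, F \in FF ->
    setsum (c j) Fs - setsum (c j) F <= setsum p Fs - setsum p F.
Proof.
have sB (f : S -> R) A : setsum (fun s => f s - p s) A = setsum f A - setsum p A.
  by rewrite /setsum sumrB.
move=> hFs; split=> [fp j F FFF | cp j].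
  have [_ /(_ F FFF)] := fp j; rewrite !sB; lra.
by split=> // F FFF; have := cp j F FFF; rewrite !sB; lra.
Qed.

End Sums.

(** * Eliminating the lowest weighted value *)

Lemma exists_between (R : realType) (I : finType) (P Q : pred I) (f g : I -> R) :
  (forall i j, P i -> Q j -> f i <= g j) ->
  exists m, (forall i, P i -> f i <= m) /\ (forall j, Q j -> m <= g j).
Proof.
move=> fg; case: (pickP P) => [i0 Pi0 | P0].
  exists (f [arg max_(i > i0 | P i) f i]%O).
  by case: Order.TotalTheory.arg_maxP => // i Pi maxi; split=> // j /(fg _ _ Pi).
case: (pickP Q) => [j0 Qj0 | Q0].
  exists (g [arg min_(j < j0 | Q j) g j]%O).
  by case: Order.TotalTheory.arg_minP => // j Qj minj; split=> // i; rewrite P0.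
by exists 0; split=> i; rewrite ?P0 ?Q0.
Qed.

Section Elimination.
Context {R : realType} {S : finType}.
Variables (FF : {set {set S}}) (Fs : {set S}) (k : nat).
Variables (c : 'I_k -> S -> R) (w : S -> R).
Hypothesis hw : forall s, 0 < w s.

Let d j F := setsum (c j) Fs - setsum (c j) F.
Let a F := invw w (Fs :\: F).
Let b F := invw w Fs - invw w F.

Lemma omega1_leP (delta : R) :
  (omega1 FF Fs c w <= delta%:E)%E <->
  forall j F, F \in FF -> b F = 0 -> d j F <= delta * a F.
Proof.
have b0 F : b F = 0 <-> invw w F = invw w Fs by rewrite /b; split; lra.
split=> [/bigmax_leP[_ o1] j F FFF /b0 Fw | o1].
  have [-> | nF] := eqVneq F Fs.
    by rewrite /d /a finset.setDv subrr /invw /setsum big_set0 mulr0.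
  have /bigmax_leP[_ /(_ F)] := o1 j isT.
  rewrite !inE nF FFF Fw eqxx => /(_ isT).
  by rewrite lee_fin ler_pdivrMr // (invw_setD_gt0 w).
apply/bigmax_leP; split=> [|j _]; first exact: leNye.
apply/bigmax_leP; split=> [|F]; first exact: leNye.
rewrite !inE => /andP[/andP[nF FFF] /eqP Fw].
rewrite lee_fin ler_pdivrMr; last exact: (invw_setD_gt0 w).
by apply: o1 => //; apply/b0.
Qed.

(** The denominator in [omega2] is positive: for [b F1 > 0] one has
    [a F1 >= b F1 > 0], and [b F3 < 0] makes the subtracted ratio
    nonpositive. Clearing it turns the bound [delta] on one ratio into the
    comparison of a lower and an upper bound for [m]. *)
Lemma omega2_ratio_le (delta : R) j1 j2 F1 F3 : 0 < b F1 -> b F3 < 0 ->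
  ((d j1 F1 / b F1 - d j2 F3 / b F3) / (a F1 / b F1 - a F3 / b F3) <= delta)
  = ((d j1 F1 - delta * a F1) / b F1 <= (d j2 F3 - delta * a F3) / b F3).
Proof.
move=> b1 b3.
have a1 : 0 < a F1 by apply: lt_le_trans b1 _; exact: invw_diff_le.
have a3 : a F3 / b F3 <= 0 by rewrite ler_ndivrMr // mul0r invw_ge0.
have a1b1 := divr_gt0 a1 b1.
rewrite ler_pdivrMr; last by rewrite subr_gt0 (le_lt_trans a3).
by rewrite !mulrBl -!mulrA; apply/idP/idP; lra.
Qed.

Lemma omega2_leP (delta : R) :
  (omega2 FF Fs c w <= delta%:E)%E <->
  forall j1 j2 F1 F3, F1 \in FF -> F3 \in FF -> 0 < b F1 -> b F3 < 0 ->
    (d j1 F1 - delta * a F1) / b F1 <= (d j2 F3 - delta * a F3) / b F3.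
Proof.
split=> [/bigmax_leP[_ o2] j1 j2 F1 F3 FF1 FF3 b1 b3 | o2].
  rewrite -omega2_ratio_le //.
  have /bigmax_leP[_ /(_ j2 isT)] := o2 j1 isT.
  move=> /bigmax_leP[_ /(_ F1)]; rewrite FF1 -subr_gt0 b1 => /(_ isT).
  move=> /bigmax_leP[_ /(_ F3)]; rewrite FF3 -subr_lt0 b3 => /(_ isT).
  by rewrite lee_fin.
apply/bigmax_leP; split=> [|j1 _]; first exact: leNye.
apply/bigmax_leP; split=> [|j2 _]; first exact: leNye.
apply/bigmax_leP; split=> [|F1]; first exact: leNye.
rewrite -subr_gt0 => /andP[FF1 b1].
apply/bigmax_leP; split=> [|F3]; first exact: leNye.
rewrite -subr_lt0 => /andP[FF3 b3].
by rewrite lee_fin omega2_ratio_le //; apply: o2.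
Qed.

(** Fourier-Motzkin elimination of [m], with [delta] as a parameter. *)
Lemma omega_leP (delta : R) :
  (maxe (omega1 FF Fs c w) (omega2 FF Fs c w) <= delta%:E)%E <->
  exists m, forall j F, F \in FF -> d j F <= delta * a F + m * b F.
Proof.
rewrite ge_max; split=> [/andP[/omega1_leP o1 /omega2_leP o2] | [m hm]].
  pose bound (i : 'I_k * {set S}) := (d i.1 i.2 - delta * a i.2) / b i.2.
  have [|m [lo up]] := @exists_between R _
    [pred i : 'I_k * {set S} | (i.2 \in FF) && (0 < b i.2)]
    [pred i : 'I_k * {set S} | (i.2 \in FF) && (b i.2 < 0)] bound bound.
    by move=> [j1 F1] [j2 F3] /andP[? ?] /andP[? ?]; apply: o2.
  exists m => j F FFF; rewrite -lerBlDl.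
  have [bneg | bpos | b0] := ltgtP (b F) 0.
  - by rewrite -ler_ndivlMr //; apply: (up (j, F)); rewrite inE FFF.
  - by rewrite -ler_pdivrMr //; apply: (lo (j, F)); rewrite inE FFF.
  - by rewrite b0 mulr0 subr_le0; apply: o1.
apply/andP; split.
  by apply/omega1_leP => j F /(hm j) dF b0; rewrite b0 mulr0 addr0 in dF.
apply/omega2_leP => j1 j2 F1 F3 /(hm j1) dF1 /(hm j2) dF3 b1 b3.
apply: (@le_trans _ _ m).
  by rewrite ler_pdivrMr // lerBlDl.
by rewrite ler_ndivlMr // lerBlDl.
Qed.

End Elimination.

(** * The min-max formula *)

Theorem theorem12 (R : realType) (S : finType) (FF : {set {set S}})
    (Fs : {set S}) (k : nat) (c : 'I_k -> S -> R) (w : S -> R)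
    (hS : (0 < #|S|)%N) (hFs : Fs \in FF) (hk : (0 < k)%N)
    (hw : forall s, 0 < w s) (hwint : forall s, 1 / w s \is a Num.int)
    (hfeas : exists p : S -> R, feasible_deviation FF Fs c p) :
  is_min [set span_w w p | p in [set p : S -> R | feasible_deviation FF Fs c p]]
    (maxe 0%E (maxe (omega1 FF Fs c w) (omega2 FF Fs c w))).
Proof.
set v := maxe _ _.
have v_le p : feasible_deviation FF Fs c p -> (v <= span_w w p)%E.
  move=> /(feasible_deviationE hFs) fp.
  have [M [m [-> bnd _]]] := span_wP w p hS.
  have pm s : m <= w s * p s by case/andP: (bnd s).
  have pM s : w s * p s <= m + (M - m) by rewrite addrC subrK; case/andP: (bnd s).
  rewrite /v ge_max; apply/andP; split.
    have /card_gt0P[s _] := hS.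
    by rewrite lee_fin subr_ge0 (le_trans (pm s)) //; case/andP: (bnd s).
  apply/omega_leP => //; exists m => j F FFF.
  exact: le_trans (fp j F FFF) (setsum_diff_le w hw Fs F pm pM).
split; last by move=> _ [p fp <-]; exact: v_le.
(* A feasible vector bounds v by a finite span, which makes v a real number. *)
have [delta vE] : exists delta : R, v = delta%:E.
  have [p0 /v_le] := hfeas.
  have [M [m [-> _ _]]] := span_wP w p0 hS.
  have : (0%:E <= v)%E by rewrite /v le_max lexx.
  by case: (v) => [x||] //; exists x.
have := lexx v; rewrite {1}/v ge_max vE lee_fin => /andP[delta0].
move=> /(omega_leP _ _ _ _ _ hw)[m hm].
have fq : feasible_deviation FF Fs c (two_level Fs w delta m).
  apply/feasible_deviationE => // j F FFF.
  by rewrite two_level_diff; apply: hm.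
exists (two_level Fs w delta m) => //.
apply/eqP; rewrite eq_le -vE v_le // andbT.
have [M [m' [-> _ [s [t [-> ->]]]]]] := span_wP w (two_level Fs w delta m) hS.
rewrite vE lee_fin !two_level_weighted //.
by case: ifP => _; case: ifP => _; lra.
Qed.
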